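(* Let $\mathcal{F}=\{f_1,\dots,f_T\}\subseteq\mathbb{R}^n$ be a finite set such that $0\in\operatorname{int}(\operatorname{conv}\mathcal{F})$ and such that $\Phi^{\mathcal{F}}(z)$ has full row rank for all $z\in\mathbb{R}^n$. Define $\mathcal{S}(z):=z+\operatorname{conv}\mathcal{F}$. Consider an initial point $z_0\in\mathbb{R}^n$ and suppose that the measurements $(Y_0,\Phi^{\mathcal{F}}(z_0))$ are such that $\phi^\gamma$ is strictly convex for all $\gamma\in\Gamma_0$. For $j\geq 1$, repeat the following two steps iteratively: first update the candidate optimizer $$z_j:=\operatorname*{arg\,min}_{z\in\mathcal{S}(z_{j-1})}\phi^+(z;\Gamma_0\cap\dots\cap\Gamma_{j-1}),\qquad (\ast)$$ and secondly measure the function $\hat\phi$ at the points $z_j+\mathcal{F}$, obtaining $Y_j=\hat\gamma^\top\Phi^{\mathcal{F}}(z_j)+W_j$ with $W_j^\top\in\mathcal{Z}(\Pi)$, and define $\Gamma_j:=\mathcal{Z}(N_j)$. Then the following hold: 1. For any $j\geq 1$, the problem $(\ast)$ is strictly convex (i.e., it minimizes a strictly convex function over a convex set). 2. For each $j\geq 1$, the algorithm provides an upper bound $$\inf_{z\in\mathbb{R}^n}\hat\phi(z)\leq\phi^+(z_j;\Gamma_0\cap\dots\cap\Gamma_{j-1}).$$ 3. The upper bounds are monotonically nonincreasing: for each $j\geq 1$, $$\phi^+(z_{j+1};\Gamma_0\cap\dots\cap\Gamma_j)\leq\phi^+(z_j;\Gamma_0\cap\dots\cap\Gamma_{j-1}).$$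 4. If $z_j\neq z_{j+1}$, then the inequality in item 3 is strict.
   Context: Conventions: $\operatorname{conv}$ and $\operatorname{int}$ denote convex hull and interior. For a symmetric matrix $P$, $P\geq 0$ (resp. $P>0$) means positive semidefinite (resp. definite); $P<0$ means $-P>0$. Let $\phi_1,\dots,\phi_k:\mathbb{R}^n\to\mathbb{R}$ be known basis functions, $b(z):=(\phi_1(z),\dots,\phi_k(z))^\top\in\mathbb{R}^k$, and for $\gamma\in\mathbb{R}^k$ let $\phi^\gamma(z):=\gamma^\top b(z)$. The unknown true function is $\hat\phi=\phi^{\hat\gamma}$ for an unknown parameter $\hat\gamma\in\mathbb{R}^k$. For $\Gamma'\subseteq\mathbb{R}^k$ define $\phi^+(z;\Gamma'):=\sup_{\gamma\in\Gamma'}\phi^\gamma(z)$. For a symmetric matrix $\Pi=\begin{bmatrix}\Pi_{11}&\Pi_{12}\\ \Pi_{21}&\Pi_{22}\end{bmatrix}\in\mathbb{R}^{(1+\ell)\times(1+\ell)}$ with $\Pi_{11}\in\mathbb{R}$, $\Pi_{22}\in\mathbb{R}^{\ell\times\ell}$, define $\mathcal{Z}(\Pi):=\{v\in\mathbb{R}^\ell \mid \begin{bmatrix}1\\ v\end{bmatrix}^\top\Pi\begin{bmatrix}1\\ v\end{bmatrix}\geq 0\}$; if $\Pi_{22}<0$, the Schur complement is $\Pi|\Pi_{22}:=\Pi_{11}-\Pi_{12}\Pi_{22}^{-1}\Pi_{21}$. Standing assumption on the noise model: $\Pi\in\mathbb{R}^{(1+T)\times(1+T)}$ is symmetric with $\Pi_{22}<0$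 and $\Pi|\Pi_{22}\geq 0$. For $\mathcal{F}=\{f_1,\dots,f_T\}\subseteq\mathbb{R}^n$ and $z\in\mathbb{R}^n$ let $\Phi^{\mathcal{F}}(z):=[\,b(z+f_1)\ \cdots\ b(z+f_T)\,]\in\mathbb{R}^{k\times T}$. At each step $j\geq 0$ the measurements are $Y_j=\hat\gamma^\top\Phi^{\mathcal{F}}(z_j)+W_j\in\mathbb{R}^{1\times T}$ with unknown noise $W_j\in\mathbb{R}^{1\times T}$, $W_j^\top\in\mathcal{Z}(\Pi)$, and the set of parameters compatible with the $j$-th set of measurements is $\Gamma_j:=\mathcal{Z}(N_j)\subseteq\mathbb{R}^k$, where $$N_j:=\begin{bmatrix}1&Y_j\\0&-\Phi^{\mathcal{F}}(z_j)\end{bmatrix}\Pi\begin{bmatrix}1&Y_j\\0&-\Phi^{\mathcal{F}}(z_j)\end{bmatrix}^\top.$$ *)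

(* Defs.v *)
From HB Require Import structures.
From mathcomp Require Import all_boot all_order all_algebra.
From mathcomp Require Import all_classical all_reals all_analysis.
Import Order.TTheory GRing.Theory Num.Theory.
Import numFieldNormedType.Exports.

Set Implicit Arguments.
Unset Strict Implicit.
Unset Printing Implicit Defensive.

Local Open Scope classical_set_scope.
Local Open Scope ring_scope.

Definition conv_hull (R : realType) (n : nat) (A : set 'cV[R]_n) : set 'cV[R]_n :=
  smallest (@convex_set R 'cV[R]_n) A.

Definition strictly_convex (R : realType) (n : nat) (f : 'cV[R]_n -> R) : Prop :=
  forall (x y : 'cV[R]_n) (t : R), x != y -> 0 < t -> t < 1 ->
    f (t *: x + (1 - t) *: y) < t * f x + (1 - t) * f y.

(* "Minimize f over S" is a strictly convex problem. Suprema take values in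
   \bar R, so the objective is also required to be real-valued, which makes
   [fine] harmless here. *)
Definition strictly_convex_problem (R : realType) (n : nat)
    (S : set 'cV[R]_n) (f : 'cV[R]_n -> \bar R) : Prop :=
  [/\ convex_set S,
      forall x, f x \is a fin_num &
      strictly_convex (fun x => fine (f x))].

Definition is_argmin (R : realType) (n : nat)
    (S : set 'cV[R]_n) (f : 'cV[R]_n -> \bar R) (z : 'cV[R]_n) : Prop :=
  S z /\ forall x, S x -> (f z <= f x)%E.

Definition negdef (R : realType) (l : nat) (P : 'M[R]_l) : Prop :=
  forall v : 'cV[R]_l, v != 0 -> 0 < (v^T *m (- P) *m v) 0 0.

Definition schur_compl (R : realType) (l : nat) (Pi : 'M[R]_(1 + l)) : R :=
  (ulsubmx Pi - ursubmx Pi *m invmx (drsubmx Pi) *m dlsubmx Pi) 0 0.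

Definition Zset (R : realType) (l : nat) (Pi : 'M[R]_(1 + l)) : set 'cV[R]_l :=
  [set v | 0 <= ((col_mx 1%:M v)^T *m Pi *m col_mx 1%:M v) 0 0].

Definition noise_model (R : realType) (T : nat) (Pi : 'M[R]_(1 + T)) : Prop :=
  [/\ Pi^T = Pi, negdef (drsubmx Pi) & 0 <= schur_compl Pi].

Section Learning.
Context (R : realType) (n k T : nat).
Variables (phi : 'I_k -> 'cV[R]_n -> R) (f : 'I_T -> 'cV[R]_n).

Definition basis_vec (z : 'cV[R]_n) : 'cV[R]_k := \col_i phi i z.

Definition phi_par (gamma : 'cV[R]_k) (z : 'cV[R]_n) : R :=
  (gamma^T *m basis_vec z) 0 0.

Definition phi_plus (Gamma : set 'cV[R]_k) (z : 'cV[R]_n) : \bar R :=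
  ereal_sup [set (phi_par gamma z)%:E | gamma in Gamma].

Definition PhiF (z : 'cV[R]_n) : 'M[R]_(k, T) :=
  \matrix_(i < k, j < T) basis_vec (z + f j) i 0.

Definition Smap (z : 'cV[R]_n) : set 'cV[R]_n :=
  [set z + x | x in conv_hull (range f)].

Definition Nmat (Pi : 'M[R]_(1 + T)) (Y : 'rV[R]_T) (z : 'cV[R]_n) :
    'M[R]_(1 + k) :=
  let B : 'M[R]_(1 + k, 1 + T) := block_mx 1%:M Y 0 (- PhiF z) in
  B *m Pi *m B^T.

Definition Gamma_at (Pi : 'M[R]_(1 + T)) (Y : nat -> 'rV[R]_T)
    (z : nat -> 'cV[R]_n) (j : nat) : set 'cV[R]_k :=
  Zset (Nmat Pi (Y j) (z j)).

(* Parameters compatible with the first j measurement sets, those with indices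
   0, ..., j - 1. *)
Definition Gamma_upto (Pi : 'M[R]_(1 + T)) (Y : nat -> 'rV[R]_T)
    (z : nat -> 'cV[R]_n) (j : nat) : set 'cV[R]_k :=
  \bigcap_(i in `I_j) Gamma_at Pi Y z i.

End Learning.

(* Main.v *)
Require Import Defs.
From HB Require Import structures.
From mathcomp Require Import all_boot all_order all_algebra.
From mathcomp Require Import all_classical all_reals all_analysis.
From mathcomp Require Import lra.
Import Order.TTheory GRing.Theory Num.Theory.
Import numFieldNormedType.Exports.

(** Write Gamma^j for the intersection of Gamma_0, ..., Gamma_(j-1).  Everything
rests on the supremum defining phi^+(x; Gamma^j) being a maximum.  The true
parameter lies in every Gamma_i, so Gamma^j is nonempty.  Since Pi_22 < 0 and
Phi^F(z_0) has full row rank, the lower right block of N_0, which is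
Phi Pi_22 Phi^T, is negative definite; hence Gamma_0 is a possibly degenerate
ellipsoid, and for j >= 1 the set Gamma^j is a closed subset of it, so it is
compact (Gamma_upto_compact), while gamma |-> phi^gamma(x) is linear
(phi_plus_attained).

A pointwise maximum of strictly convex functions is strictly convex: at a
proper convex combination of x and y, bound the single function attaining the
maximum there (phi_plus_strictly_convex).  A mere supremum would only yield
the weak inequality.  This gives the strict convexity of the problems.

The upper bound holds because the true parameter is among the candidates.  For
monotonicity, 0 in conv F makes z_j feasible for the problem defining z_(j+1),
and passing from Gamma^j to Gamma^(j+1) can only decrease phi^+ at z_j.  If
z_j differs from z_(j+1), then z_j is not the minimizer of that problem, and a
strictly convex problem has no second minimizer (argmin_unique), so the first of
these two steps is strict. *)

Set Implicit Arguments.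
Unset Strict Implicit.

Local Open Scope classical_set_scope.
Local Open Scope ring_scope.

(** * Ellipsoids *)

Lemma negdef_unitmx (R : realType) (l : nat) (P : 'M[R]_l) :
  P^T = P -> negdef P -> P \in unitmx.
Proof.
move=> Psym Pneg; rewrite -row_free_unit -kermx_eq0; apply/eqP/row_matrixP => i.
rewrite row0; set w := row i _.
have wP : w *m P = 0 by rewrite /w -row_mul mulmx_ker row0.
apply: trmx_inj; rewrite trmx0; apply/eqP/negP => /negP wn0.
have := Pneg w^T wn0.
by rewrite trmxK mulmxN wP oppr0 mul0mx mxE ltxx.
Qed.

Lemma negdef_ge0 (R : realType) (l : nat) (P : 'M[R]_l) (v : 'cV[R]_l) :
  negdef P -> 0 <= (v^T *m (- P) *m v) 0 0.
Proof.
move=> Pneg; have [->|/Pneg/ltW //] := eqVneq v 0.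
by rewrite mulmx0 mxE.
Qed.

(** An ellipsoid is bounded.  With A := - N_22 > 0 and c := N_21, membership of v
reads v^T A v <= N_11 + 2 v^T c.  Let e_i be the i-th basis vector and take
h := A^-1 (c + s e_i).  Expanding (v - h)^T A (v - h) >= 0 produces the
term - 2 v^T (c + s e_i); the quadratic and the c terms cancel against the
membership inequality, leaving 2 s v_i <= N_11 + h^T A h.  The choices s = 1
and s = -1 bound v_i on both sides, without any eigenvalue estimate. *)
Lemma Zset_coord_bounded (R : realType) (l : nat) (N : 'M[R]_(1 + l))
    (i : 'I_l) :
  N^T = N -> negdef (drsubmx N) ->
  exists a b : R, forall v, Zset N v -> a <= v i 0 <= b.
Proof.
move=> Nsym Nneg.
set A := - drsubmx N; set c := dlsubmx N.
have Asym : (drsubmx N)^T = drsubmx N by rewrite trmx_drsub Nsym.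
have AT : A^T = A by rewrite /A linearN /= Asym.
pose h (s : R) : 'cV[R]_l := - (invmx (drsubmx N) *m (c + s *: delta_mx i 0)).
have Ah s : A *m h s = c + s *: delta_mx i 0.
  by rewrite mulNmx mulmxN opprK mulKVmx // negdef_unitmx.
pose K s := (ulsubmx N 0 0 + ((h s)^T *m A *m h s) 0 0) / 2.
have key v s : Zset N v -> s * v i 0 <= K s.
  rewrite /Zset /= -[X in _ *m X *m _]submxK tr_col_mx mul_row_block mul_row_col.
  rewrite trmx1 !mul1mx !mulmx1 => Zv.
  have urE : ursubmx N = c^T by rewrite /c trmx_dlsub Nsym.
  have dr : drsubmx N = - A by rewrite /A opprK.
  have := @negdef_ge0 _ _ _ (v - h s) Nneg; rewrite -/A.
  have -> : (v - h s)^T *m A *m (v - h s) = v^T *m A *m v - v^T *m (A *m h s)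
      - (A *m h s)^T *m v + (h s)^T *m A *m h s.
    rewrite trmx_mul AT [(v - h s)^T]linearB /= mulmxBl mulmxBr !mulmxBl !mulmxA.
    by rewrite opprB addrA [LHS]addrAC [X in X + _ = _]addrAC.
  move: Zv; rewrite urE dr -/c Ah [(c + _)^T]linearD /= [(s *: _)^T]linearZ /=.
  rewrite !mulmxDr !mulmxDl mulmxN mulNmx.
  rewrite -scalemxAr -scalemxAl trmx_delta -colE -rowE.
  have -> : c^T *m v = v^T *m c.
    by rewrite -[LHS]trmxK trmx_mul trmxK [LHS]mx11_scalar [RHS]mx11_scalar mxE.
  rewrite /K !mxE.
  lra.
exists (- K (-1)), (K 1) => v Zv.
have := key v 1 Zv; have := key v (-1) Zv.
rewrite mul1r mulN1r => h1 ->; rewrite andbT; lra.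
Qed.

Lemma continuous_mulmx_entry (R : realType) (X : topologicalType) (m p q : nat)
    (A : X -> 'M[R]_(m, p)) (B : X -> 'M[R]_(p, q)) :
  (forall i j, continuous (fun x => A x i j)) ->
  (forall i j, continuous (fun x => B x i j)) ->
  forall i j, continuous (fun x => (A x *m B x) i j).
Proof.
move=> Acont Bcont i j.
have -> : (fun x => (A x *m B x) i j) = \sum_h (fun x => A x i h * B x h j).
  by apply/funext => x; rewrite mxE fct_sumE.
elim/big_ind: _ => [|g1 g2 g1c g2c|h _] x.
- exact: cvg_cst.
- exact: (cvgD (g1c x) (g2c x)).
- exact: (cvgM (Acont i h x) (Bcont h j x)).
Qed.

(** Parameter sets are transposed into row vectors because the Heine-Borel and
extreme value theorems used below are about row vectors. *)
Lemma Zset_row_closed (R : realType) (l : nat) (N : 'M[R]_(1 + l)) :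
  closed [set v : 'rV[R]_l | Zset N v^T].
Proof.
pose q (v : 'rV[R]_l) : R := ((row_mx 1%:M v) *m N *m (row_mx 1%:M v)^T) 0 0.
have -> : [set v : 'rV[R]_l | Zset N v^T] = q @^-1` [set t | 0 <= t].
  by apply/funext => v; rewrite /q /Zset /= tr_col_mx trmx1 trmxK tr_row_mx trmx1.
have coord i j :
    continuous (fun v : 'rV[R]_l => row_mx (1%:M : 'M[R]_1) v i j).
  rewrite -[j]fintype.splitK; case: (fintype.split j) => h /=.
    under [X in continuous X]funext => v do rewrite row_mxEl.
    exact: cst_continuous.
  under [X in continuous X]funext => v do rewrite row_mxEr.
  exact: coord_continuous.
apply: preimage_closed; last exact: closed_ge.
move=> v _; apply: continuous_mulmx_entry => [{}i j|i j].
  by apply: continuous_mulmx_entry => // h h'; exact: cst_continuous.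
under [X in continuous X]funext => w do rewrite mxE.
exact: coord.
Qed.

Lemma Zset_row_compact (R : realType) (l : nat) (N : 'M[R]_(1 + l)) :
  N^T = N -> negdef (drsubmx N) -> compact [set v : 'rV[R]_l | Zset N v^T].
Proof.
move=> Nsym Nneg.
have [a /choice[b abP]] := choice (fun i => Zset_coord_bounded i Nsym Nneg).
apply: (subclosed_compact (@Zset_row_closed R l N)).
  exact: (rV_compact (fun i => segment_compact (a := a i) (b := b i))).
by move=> v /= Zv i; rewrite /= in_itv /=; have := abP i _ Zv; rewrite mxE.
Qed.

(** * Convexity *)

Lemma conv_hull_convex (R : realType) (n : nat) (A : set 'cV[R]_n) :
  convex_set (conv_hull A).
Proof.
move=> x y t /set_mem Ax /set_mem Ay; apply/mem_set => C [Cconv AC].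
by apply/set_mem/Cconv; apply/mem_set; [exact: Ax|exact: Ay].
Qed.

(** If y were another minimizer, the midpoint of x and y would be feasible with
a strictly smaller value. *)
Lemma argmin_unique (R : realType) (n : nat) (S : set 'cV[R]_n)
    (g : 'cV[R]_n -> \bar R) (x y : 'cV[R]_n) :
  strictly_convex_problem S g -> is_argmin S g x -> S y -> y != x ->
  (g x < g y)%E.
Proof.
move=> [Sconv gfin gsc] [Sx xmin] Sy yx.
rewrite lt_neqAle xmin // andbT; apply/eqP => gxy.
have h0 : 0 < 2^-1 :> R by lra.
have h1 : 2^-1 < 1 :> R by lra.
pose t := Itv01 (ltW h0) (ltW h1).
have Sm : S (2^-1 *: y + (1 - 2^-1) *: x).
  by apply: set_mem; apply: (Sconv y x t); exact: mem_set.
have := xmin _ Sm; apply/negP; rewrite -ltNge.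
have := gsc y x 2^-1 yx h0 h1; rewrite /= -gxy -mulrDl subrKC mul1r.
by rewrite -lte_fin !fineK.
Qed.

(** * Compatible parameters and their upper envelope *)

Section Learning_theory.
Context (R : realType) (n k T : nat).
Variables (phi : 'I_k -> 'cV[R]_n -> R) (f : 'I_T -> 'cV[R]_n).

Lemma Nmat_sym (Pi : 'M[R]_(1 + T)) (Y : 'rV[R]_T) (x : 'cV[R]_n) :
  Pi^T = Pi -> (Nmat phi f Pi Y x)^T = Nmat phi f Pi Y x.
Proof. by move=> Pisym; rewrite /Nmat !trmx_mul trmxK Pisym mulmxA. Qed.

Lemma drsubmx_Nmat (Pi : 'M[R]_(1 + T)) (Y : 'rV[R]_T) (x : 'cV[R]_n) :
  drsubmx (Nmat phi f Pi Y x) =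
    PhiF phi f x *m drsubmx Pi *m (PhiF phi f x)^T.
Proof.
rewrite /Nmat -[in LHS](submxK Pi) tr_block_mx !mulmx_block block_mxKdr.
by rewrite trmx0 !mul0mx !mulmx0 !add0r linearN /= mulmxN !mulNmx opprK.
Qed.

Lemma Nmat_negdef (Pi : 'M[R]_(1 + T)) (Y : 'rV[R]_T) (x : 'cV[R]_n) :
  negdef (drsubmx Pi) -> row_free (PhiF phi f x) ->
  negdef (drsubmx (Nmat phi f Pi Y x)).
Proof.
move=> Pineg Phifree v vn0; rewrite drsubmx_Nmat.
have := Pineg ((PhiF phi f x)^T *m v); rewrite trmx_mul trmxK.
rewrite mulmxN !mulNmx !mulmxN mulNmx !mulmxA; apply.
apply: contra_neq vn0 => Phiv0; apply: trmx_inj.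
rewrite -[v^T](mulmxKp Phifree) -[v^T *m _]trmxK trmx_mul trmxK Phiv0.
by rewrite !trmx0 mul0mx.
Qed.

(** The residual Y - gammah^T Phi is the noise w, so the quadratic form of N at
gammah is that of Pi at w. *)
Lemma Nmat_true_param (Pi : 'M[R]_(1 + T)) (w : 'rV[R]_T) (gammah : 'cV[R]_k)
    (x : 'cV[R]_n) :
  Zset Pi w^T -> Zset (Nmat phi f Pi (gammah^T *m PhiF phi f x + w) x) gammah.
Proof.
rewrite /Zset /Nmat /=; set B := block_mx _ _ _ _.
suff <- : B^T *m col_mx 1%:M gammah = col_mx 1%:M w^T.
  by rewrite trmx_mul trmxK !mulmxA.
rewrite /B tr_block_mx mul_block_col trmx1 trmx0 mul1mx mul0mx addr0 mulmx1.
congr col_mx.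
by rewrite linearD /= trmx_mul trmxK linearN /= mulNmx addrC addKr.
Qed.

Lemma phi_plus_attained (Gamma : set 'cV[R]_k) (x : 'cV[R]_n) :
  Gamma !=set0 -> compact [set v : 'rV[R]_k | Gamma v^T] ->
  exists2 gamma, Gamma gamma & phi_plus phi Gamma x = (phi_par phi gamma x)%:E.
Proof.
move=> [g0 Gg0] Gcompact.
have [||v /set_mem Gv vmax] :=
    @EVT_max_rV R k (fun v => phi_par phi v^T x) [set v | Gamma v^T] _ Gcompact.
- by exists g0^T; rewrite /= trmxK.
- apply: continuous_subspaceT => v; rewrite /phi_par.
  apply: continuous_mulmx_entry => i j; last exact: cst_continuous.
  under [X in continuous X]funext => w do rewrite trmxK.
  exact: coord_continuous.
exists v^T; first exact: Gv.
apply/eqP; rewrite eq_le; apply/andP; split.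
  apply: ge_ereal_sup => _ [g Gg <-]; rewrite lee_fin -[g]trmxK.
  by apply: vmax; rewrite inE /= trmxK.
by apply: ereal_sup_ubound; exists v^T.
Qed.

Lemma phi_plus_ub (Gamma : set 'cV[R]_k) (gamma : 'cV[R]_k) (x : 'cV[R]_n) :
  Gamma gamma -> ((phi_par phi gamma x)%:E <= phi_plus phi Gamma x)%E.
Proof. by move=> Gg; apply: ereal_sup_ubound; exists gamma. Qed.

Lemma phi_plus_mono (Gamma Gamma' : set 'cV[R]_k) (x : 'cV[R]_n) :
  Gamma `<=` Gamma' -> (phi_plus phi Gamma x <= phi_plus phi Gamma' x)%E.
Proof.
by move=> sG; apply: le_ereal_sup => _ [g Gg <-]; exists g => //; exact: sG.
Qed.

(** The maximizing parameter at the convex combination depends on the two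
points; its own strict inequality is then relaxed to phi^+ at the endpoints. *)
Lemma phi_plus_strictly_convex (Gamma : set 'cV[R]_k) (S : set 'cV[R]_n) :
  Gamma !=set0 -> compact [set v : 'rV[R]_k | Gamma v^T] ->
  (forall gamma, Gamma gamma -> strictly_convex (phi_par phi gamma)) ->
  convex_set S -> strictly_convex_problem S (phi_plus phi Gamma).
Proof.
move=> G0 Gcompact Gsc Sconv.
have fin x : phi_plus phi Gamma x \is a fin_num.
  by have [g _ ->] := phi_plus_attained x G0 Gcompact.
split=> // x y t xy t0 t1.
have [g Gg ->] := phi_plus_attained (t *: x + (1 - t) *: y) G0 Gcompact.
apply: (lt_le_trans (Gsc g Gg x y t xy t0 t1)).
have gle u : phi_par phi g u <= fine (phi_plus phi Gamma u).
  by rewrite -lee_fin fineK // phi_plus_ub.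
by apply: lerD; apply: ler_wpM2l; rewrite ?gle // ?subr_ge0 ltW.
Qed.

Lemma Smap_convex (x : 'cV[R]_n) : convex_set (Smap f x).
Proof.
move=> u v t /set_mem[u' hu' <-] /set_mem[v' hv' <-]; apply/mem_set.
exists (t%:num *: u' + (1 - t%:num) *: v').
  apply/set_mem; apply: (conv_hull_convex (x := u') (y := v') t);
    exact: mem_set.
by rewrite /conv /= !scalerDr addrACA -scalerDl subrKC scale1r.
Qed.

Lemma Smap_self (x : 'cV[R]_n) : (conv_hull (range f))^° 0 -> Smap f x x.
Proof. by move=> /interior_subset h0; exists 0 => //; rewrite addr0. Qed.

(** Each measurement contributes a closed set, and Gamma_0 is a compact one. *)
Lemma Gamma_upto_compact (Pi : 'M[R]_(1 + T)) (Y : nat -> 'rV[R]_T)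
    (z : nat -> 'cV[R]_n) (j : nat) :
  Pi^T = Pi -> negdef (drsubmx Pi) -> row_free (PhiF phi f (z 0%N)) ->
  (0 < j)%N -> compact [set v : 'rV[R]_k | Gamma_upto phi f Pi Y z j v^T].
Proof.
move=> Pisym Pineg Phifree j0.
apply: (@subclosed_compact _ _ [set v | Gamma_at phi f Pi Y z 0 v^T]).
- rewrite (_ : [set _ | _] =
      \bigcap_(i in `I_j) [set v | Gamma_at phi f Pi Y z i v^T]).
    by apply: closed_bigI => i _; exact: Zset_row_closed.
  by apply/seteqP; split.
- by apply: Zset_row_compact; [exact: Nmat_sym|exact: Nmat_negdef].
- by move=> v; exact.
Qed.

End Learning_theory.

Unset Implicit Arguments.

Theorem mainTheorem7 (R : realType) (n k T : nat)
  (phi : 'I_k -> 'cV[R]_n -> R) (gammah : 'cV[R]_k)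
  (Pi : 'M[R]_(1 + T)) (f : 'I_T -> 'cV[R]_n)
  (z : nat -> 'cV[R]_n) (Y W : nat -> 'rV[R]_T)
  (hPi : noise_model Pi)
  (hF : (conv_hull (range f))^° 0)
  (hPhi : forall x : 'cV[R]_n, row_free (PhiF phi f x))
  (hW : forall j : nat, Zset Pi (W j)^T)
  (hY : forall j : nat, Y j = gammah^T *m PhiF phi f (z j) + W j)
  (hconv : forall gamma : 'cV[R]_k, Gamma_at phi f Pi Y z 0%N gamma ->
     strictly_convex (phi_par phi gamma))
  (hz : forall j : nat, (1 <= j)%N ->
     is_argmin (Smap f (z j.-1))
       (phi_plus phi (Gamma_upto phi f Pi Y z j)) (z j)) :
  [/\ forall j : nat, (1 <= j)%N ->
        strictly_convex_problem (Smap f (z j.-1))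
          (phi_plus phi (Gamma_upto phi f Pi Y z j)),
      forall j : nat, (1 <= j)%N ->
        (ereal_inf (range (fun x : 'cV[R]_n => (phi_par phi gammah x)%:E))
           <= phi_plus phi (Gamma_upto phi f Pi Y z j) (z j))%E,
      forall j : nat, (1 <= j)%N ->
        (phi_plus phi (Gamma_upto phi f Pi Y z j.+1) (z j.+1)
           <= phi_plus phi (Gamma_upto phi f Pi Y z j) (z j))%E &
      forall j : nat, (1 <= j)%N -> z j != z j.+1 ->
        (phi_plus phi (Gamma_upto phi f Pi Y z j.+1) (z j.+1)
           < phi_plus phi (Gamma_upto phi f Pi Y z j) (z j))%E].
Proof.
have [Pisym Pineg _] := hPi.
have true_param j : Gamma_upto phi f Pi Y z j gammah.
  by move=> i _; rewrite /Gamma_at hY; exact: Nmat_true_param.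
have convex_problem j x : (1 <= j)%N ->
    strictly_convex_problem (Smap f x)
      (phi_plus phi (Gamma_upto phi f Pi Y z j)).
  move=> j0; apply: phi_plus_strictly_convex; last exact: Smap_convex.
  - by exists gammah.
  - exact: Gamma_upto_compact.
  - by move=> gamma Ggamma; apply: hconv; exact: Ggamma.
have shrink j : (phi_plus phi (Gamma_upto phi f Pi Y z j.+1) (z j) <=
    phi_plus phi (Gamma_upto phi f Pi Y z j) (z j))%E.
  by apply: phi_plus_mono => gamma Ggamma i ij; apply: Ggamma; exact: ltnW.
have Sself j : Smap f (z j) (z j) by exact: Smap_self.
split=> j j1; first exact: convex_problem.
- apply: le_trans (phi_plus_ub _ _ (true_param j)).
  by apply: ereal_inf_lbound; exists (z j).
- exact: (le_trans ((hz j.+1 isT).2 _ (Sself j)) (shrink j)).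
- move=> zj; apply: lt_le_trans (shrink j).
  exact: argmin_unique (convex_problem j.+1 (z j) isT) (hz j.+1 isT) (Sself j)
    zj.
Qed.
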